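(* Let $S = \operatorname{stack}(P, Q) \in \mathrm{SYT}(2r \times c)$ where $P, Q \in \mathrm{SYT}(r \times c)$ and $n \coloneqq rc$. Let $\rho_i \coloneqq \operatorname{prom}_i(S) \in \mathfrak{S}_{2n}$ for $1 \leq i \leq 2r-1$. Then \begin{equation*} \mathcal{V}(\mathcal{P}^{\mathrm{NE}}(\rho_r), \nearrow) = (\mathcal{E}(P), Q). \end{equation*} Furthermore, for $0 \leq k \leq r-1$, \begin{equation*} \begin{split} \mathcal{P}^{\mathrm{NE}}(\rho_{r+k}) &= \mathcal{S}^k(\mathcal{P}^{\mathrm{NE}}(\rho_r), \nearrow) \\ \mathcal{P}^{\mathrm{NE}}(\rho_{r-k}) &= \mathcal{S}^k(\mathcal{P}^{\mathrm{NE}}(\rho_r), \swarrow). \end{split} \end{equation*} More precisely, the skeleton of the $j$-th shadow line of the skeleton $\mathcal{S}^k(\mathcal{P}^{\mathrm{NE}}(\rho_r), \nearrow)$ (or $\mathcal{S}^k(\mathcal{P}^{\mathrm{NE}}(\rho_r), \swarrow)$) is the $j$-th shadow line of the next skeleton $\mathcal{S}^{k+1}(\mathcal{P}^{\mathrm{NE}}(\rho_r), \nearrow)$ (or $\mathcal{S}^{k+1}(\mathcal{P}^{\mathrm{NE}}(\rho_r), \swarrow)$).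
   Context: $\mathrm{SYT}(r \times c)$ is the set of standard Young tableaux of rectangular shape with $r$ rows and $c$ columns. For $P, Q \in \mathrm{SYT}(r\times c)$ with $n = rc$, $\operatorname{stack}(P,Q) \in \mathrm{SYT}(2r \times c)$ is obtained by adding $n$ to every entry of $Q$ and placing the result below $P$. $\mathcal{E}$ denotes Schützenberger evacuation. Gromotion of a tableau deletes its smallest entry, rectifies by jeu de taquin slides until the empty cell reaches an outer corner, and fills that corner with (largest entry)$+1$, without decrementing entries. For $T \in \mathrm{SYT}(R \times c)$ with $N = Rc$, the $i$-th promotion permutation $\operatorname{prom}_i(T) \in \mathfrak{S}_N$ ($1 \le i \le R-1$) lists the entries that slide into row $i$ when computing the successive gromotions $g(T), g^2(T), \ldots, g^N(T)$, taken modulo $N$ with residues in $\{1,\ldots,N\}$. A permutation $\rho \in \mathfrak{S}_{2n}$ is identified with the $2n\times 2n$ matrix $M(\rho)$ with $M_{i,\rho(i)} = 1$ and $0$ elsewhere; $M(\rho)^{\mathrm{NE}}$ is its northeast $n\times n$ block (rows $1,\ldots,n$, columns $n+1,\ldots,2n$). For an $n\times n$ $0/1$ matrix $M$ with at most one nonzero entry per row and column, $\mathcal{P}(M) \coloneqq \{(y, n+1-x) \mid M_{xy} = 1\} \subseteq [n]\times[n]$, and $\mathcal{P}^{\mathrm{NE}}(\rho) \coloneqq \mathcal{P}(M(\rho)^{\mathrm{NE}})$. On $\mathbb{Z}\times\mathbb{Z}$ define $(a,b)\nearrow(x,y)$ iff $a\le x$ and $b\le y$, and $(a,b)\swarrow(x,y)$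 iff $a\ge x$ and $b\ge y$. Let $\mathcal{P}$ be a finite set of points with pairwise distinct $x$-coordinates and pairwise distinct $y$-coordinates. For a direction $\nearrow$ (and verbatim for $\swarrow$): the first shadow line $\mathcal{L}_1(\mathcal{P},\nearrow)$ is the set of minimal elements of $\mathcal{P}$ under $\nearrow$, and the $j$-th shadow line $\mathcal{L}_j(\mathcal{P},\nearrow)$ is the set of minimal elements of $\mathcal{P}$ minus the earlier shadow lines. The skeleton $\mathcal{S}(\mathcal{L},\nearrow)$ of a shadow line $\mathcal{L}$ is the set of minimal elements under $\nearrow$ of the region of points lying in the shadow (points weakly north-east, i.e. $\nearrow$-above) of at least two points of $\mathcal{L}$; the skeleton of $\mathcal{P}$ is $\mathcal{S}(\mathcal{P},\nearrow) = \bigcup_j \mathcal{S}(\mathcal{L}_j(\mathcal{P},\nearrow),\nearrow)$, and $\mathcal{S}^0(\mathcal{P},\nearrow)=\mathcal{P}$, $\mathcal{S}^{i+1}(\mathcal{P},\nearrow)=\mathcal{S}(\mathcal{S}^i(\mathcal{P},\nearrow),\nearrow)$. Viennot's construction $\mathcal{V}(\mathcal{P},\nearrow) = (A,B)$: draw the shadow lines of all skeleta $\mathcal{S}^i(\mathcal{P},\nearrow)$, labeling those coming from the $i$-th skeleton with $i+1$; reading labels along the extreme right edge bottom-to-top gives a lattice word $w_A$, and along the extreme top edge left-to-right gives a lattice word $w_B$; $A$, $B$ are the standard tableaux whose lattice words are these (entry $i$ lies in row $w_i$). *)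

(* Defs.v *)
From mathcomp Require Import all_boot all_order all_algebra.
From mathcomp Require Import all_classical.

Set Implicit Arguments.
Unset Strict Implicit.
Unset Printing Implicit Defensive.

Import Order.TTheory GRing.Theory Num.Theory.

Local Open Scope ring_scope.
Local Open Scope classical_set_scope.
Local Open Scope nat_scope.

(* A tableau is the list of its rows.  Cells (i, j) are counted from 0; entries,
   the row index of [prom] and the letters of lattice words are counted
   from 1. *)
Definition tableau := seq (seq nat).

Definition cell := (nat * nat)%type.

Definition has_cell (T : tableau) (p : cell) : bool :=
  p.2 < size (nth [::] T p.1).

Definition entry (T : tableau) (p : cell) : nat :=
  nth 0 (nth [::] T p.1) p.2.

Definition set_entry (T : tableau) (p : cell) (v : nat) : tableau :=
  set_nth [::] T p.1 (set_nth 0 (nth [::] T p.1) p.2 v).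

Definition drop_cell (T : tableau) (p : cell) : tableau :=
  set_nth [::] T p.1 (take p.2 (nth [::] T p.1)).

Definition is_SYT (r c : nat) (T : tableau) : Prop :=
  [/\ shape T = nseq r c,
      perm_eq (flatten T) (iota 1 (r * c)),
      forall i j, i < r -> j.+1 < c -> entry T (i, j) < entry T (i, j.+1)
    & forall i j, i.+1 < r -> j < c -> entry T (i, j) < entry T (i.+1, j)].

Definition stack (n : nat) (P Q : tableau) : tableau :=
  P ++ [seq [seq n + x | x <- row] | row <- Q].

(* The cell whose entry slides into the empty cell [p]. *)
Definition jdt_next (T : tableau) (p : cell) : option cell :=
  let right := (p.1, p.2.+1) in
  let below := (p.1.+1, p.2) in
  if has_cell T right then
    if has_cell T below && (entry T below < entry T right)
    then Some below else Some right
  else if has_cell T below then Some below else None.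

Fixpoint jdt_path_rec (fuel : nat) (T : tableau) (p : cell) : seq cell :=
  p :: (if fuel is fuel'.+1 then
          if jdt_next T p is Some q then jdt_path_rec fuel' T q else [::]
        else [::]).

(* The successive positions of the empty cell after deletion of the smallest
   entry, which sits at (0, 0).  The positions are distinct cells of [T], so
   the fuel never runs out. *)
Definition jdt_path (T : tableau) : seq cell :=
  jdt_path_rec (size (flatten T)) T (0, 0).

Definition jdt_end (T : tableau) : cell := last (0, 0) (jdt_path T).

(* Pairs (p, q) such that the entry in cell q slides into cell p. *)
Definition jdt_moves (T : tableau) : seq (cell * cell) :=
  zip (jdt_path T) (behead (jdt_path T)).

(* The cell [jdt_end T] of the result is meant to be empty: its content is
   irrelevant, and is overwritten or dropped below. *)
Definition jdt_slide (T : tableau) : tableau :=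
  foldl (fun U m => set_entry U m.1 (entry T m.2)) T (jdt_moves T).

Definition gromotion (T : tableau) : tableau :=
  set_entry (jdt_slide T) (jdt_end T) (\max_(x <- flatten T) x).+1.

(* Entries moving up into the row of index i (from 0) during [gromotion T]. *)
Definition slide_into_row (T : tableau) (i : nat) : seq nat :=
  [seq entry T m.2 | m <- jdt_moves T & (m.1.1 == i) && (m.2.1 == i.+1)].

Definition residue (N x : nat) : nat := (x.-1 %% N).+1.

(* One-line notation of the i-th promotion permutation. *)
Definition prom (i : nat) (T : tableau) : seq nat :=
  let N := size (flatten T) in
  flatten [seq [seq residue N x | x <- slide_into_row (iter m gromotion T) i.-1]
          | m <- iota 0 N].

(* Schuetzenberger evacuation: the smallest entry of T is repeatedly deleted
   and the remaining tableau rectified; the cells successively vacated receive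
   m, m - 1, ..., 1 in the result U. *)
Fixpoint evacuation_rec (m : nat) (T U : tableau) : tableau :=
  if m is m'.+1 then
    evacuation_rec m' (drop_cell (jdt_slide T) (jdt_end T))
                      (set_entry U (jdt_end T) m)
  else U.

Definition evacuation (T : tableau) : tableau :=
  evacuation_rec (size (flatten T)) T T.

Definition perm_matrix (N : nat) (w : seq nat) : 'M[nat]_N :=
  \matrix_(i < N, j < N) (nth 0 w i == j.+1 : nat).

Definition lpoint := (int * int)%type.

(* x and y count from 0 here, whence the shifts in (y, n + 1 - x). *)
Definition points_of_matrix (n : nat) (M : 'M[nat]_n) : set lpoint :=
  [set p | exists x y : 'I_n,
     M x y = 1 /\ p = ((y.+1)%:Z, (n.+1)%:Z - (x.+1)%:Z)%R].

Definition points_NE (n : nat) (w : seq nat) : set lpoint :=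
  points_of_matrix (ursubmx (perm_matrix (n + n) w)).

Definition ne_le : rel lpoint :=
  fun p q => ((p.1 <= q.1) && (p.2 <= q.2))%R.

Definition sw_le : rel lpoint :=
  fun p q => ((p.1 >= q.1) && (p.2 >= q.2))%R.

Definition minimals (le : rel lpoint) (A : set lpoint) : set lpoint :=
  [set p | A p /\ forall q, A q -> le q p -> q = p].

(* What is left of A once its first j shadow lines are removed. *)
Fixpoint shadow_rest (le : rel lpoint) (A : set lpoint) (j : nat) : set lpoint :=
  if j is j'.+1 then
    shadow_rest le A j' `\` minimals le (shadow_rest le A j')
  else A.

(* Lines are counted from 0: this is the (j + 1)-st shadow line. *)
Definition shadow_line (le : rel lpoint) (A : set lpoint) (j : nat) : set lpoint :=
  minimals le (shadow_rest le A j).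

Definition line_skeleton (le : rel lpoint) (L : set lpoint) : set lpoint :=
  minimals le
    [set p | exists a b, [/\ L a, L b, a <> b, le a p & le b p]].

Definition skeleton (le : rel lpoint) (A : set lpoint) : set lpoint :=
  \bigcup_j line_skeleton le (shadow_line le A j).

Definition iter_skeleton (k : nat) (le : rel lpoint) (A : set lpoint) :
    set lpoint :=
  iter k (skeleton le) A.

Definition shadow (L : set lpoint) : set lpoint :=
  [set p | exists2 a, L a & ne_le a p].

(* The polygonal line drawn for L is the south-west boundary of its shadow. *)
Definition drawn_line (L : set lpoint) : set lpoint :=
  [set p | shadow L p /\ ~ shadow L (p.1 - 1, p.2 - 1)%R].

Definition has_label (A : set lpoint) (p : lpoint) (l : nat) : Prop :=
  exists i j,
    l = i.+1 /\ drawn_line (shadow_line ne_le (iter_skeleton i ne_le A) j) p.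

(* The unique label at p; 0, which is not a label, if there is none or more
   than one. *)
Definition label (A : set lpoint) (p : lpoint) : nat :=
  xget 0 [set l | forall l', has_label A p l' <-> l' = l].

(* For A inside [1, n] x [1, n], the extreme right and top edges are x = n + 1
   and y = n + 1, where the drawn lines have become straight rays. *)
Definition right_word (n : nat) (A : set lpoint) : seq nat :=
  [seq label A ((n.+1)%:Z, y%:Z)%R | y <- iota 1 n].

Definition top_word (n : nat) (A : set lpoint) : seq nat :=
  [seq label A (x%:Z, (n.+1)%:Z)%R | x <- iota 1 n].

Definition tableau_of_word (w : seq nat) : tableau :=
  [seq [seq k <- iota 1 (size w) | nth 0 w k.-1 == l]
  | l <- iota 1 (\max_(x <- w) x)].

Definition viennot (n : nat) (A : set lpoint) : tableau * tableau :=
  (tableau_of_word (right_word n A), tableau_of_word (top_word n A)).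

(* Main.v *)
Require Import Defs.
From mathcomp Require Import all_boot all_order all_algebra.
From mathcomp Require Import all_classical.
From mathcomp Require Import zify.

(** Write [E] for the evacuation of [P]. During the first [n] gromotions of
    [stack n P Q] the entries of [Q] only move vertically: after [m] steps,
    column [j] consists of column [j] of the partially evacuated [P], then of
    column [j] of [n + Q], then of entries larger than [2n]. Indeed, if the
    slide inside [P] ends at a corner (a, b), column [b + 1] of [Q] has already
    been raised at least one row above column [b], so every entry of [Q] met
    below the hole is smaller than its right competitor and the hole runs
    straight down column [b]. As (a, b) is the cell of [n - m] in [E], counting
    rows from 0, the points of the i-th promotion permutation are (Q (i - 1 - a,
    b), E (a, b)). In this form, for direction north-east, column [b] of the
    grid is the b-th shadow line, and passing to the skeleton joins consecutive
    points of a column, i.e. shifts the index of [E] by one; the direction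
    south-west is the same statement for the reversed order and the reversed
    indices. *)

Set Implicit Arguments.
Unset Strict Implicit.
Unset Printing Implicit Defensive.

Local Open Scope classical_set_scope.
Local Open Scope nat_scope.

(** * Shadow lines of grids of points *)

Section ColumnsAsShadowLines.

Variables (R : rel int) (c : nat).
Hypothesis R_refl : forall x, R x x.
Hypothesis R_anti : forall x y, R x y -> R y x -> x = y.
Hypothesis R_trans : forall x y z, R x y -> R y z -> R x z.

(** With [R] taken as [<=] or [>=] this is convertible to [ne_le] or [sw_le], so one argument serves
    both directions. *)
Definition prod_le : rel lpoint := fun p q => R p.1 q.1 && R p.2 q.2.

(** The index [j] drops the columns before [j], so that the family is closed under removal of shadow
    lines. *)
Definition grid_points (d : nat) (f g : nat -> nat -> int) (j : nat) :
    set lpoint :=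
  [set p | exists a b, [/\ a < d, j <= b, b < c & p = (f a b, g a b)]].

Definition grid_column (d : nat) (f g : nat -> nat -> int) (j : nat) :
    set lpoint :=
  [set p | exists a, [/\ a < d, j < c & p = (f a j, g a j)]].

(* The strictness clauses make every column an antichain and make column b + 1
   lie above column b. *)
Definition grid_mono (d : nat) (f g : nat -> nat -> int) : Prop :=
  (forall a a' b b', a <= a' -> a' < d -> b <= b' -> b' < c ->
     R (f a' b) (f a b') /\ (R (f a b') (f a' b) -> a = a' /\ b = b')) /\
  (forall a a' b b', a <= a' -> a' < d -> b <= b' -> b' < c ->
     R (g a b) (g a' b') /\ (R (g a' b') (g a b) -> a = a' /\ b = b')).

Section Fixed.

Variables (d : nat) (f g : nat -> nat -> int).
Hypothesis fg : grid_mono d f g.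

(** The ordinates decide when [a <= a'], the abscissas when [a' < a]. Hence columns are antichains,
    and no point of a later column lies below one of an earlier column. *)
Lemma grid_le_eq a b a' b' : a < d -> a' < d -> b < c -> b <= b' -> b' < c ->
  R (f a' b') (f a b) -> R (g a' b') (g a b) -> a = a' /\ b = b'.
Proof.
case: fg => Hf Hg ad a'd bc bb' b'c Rf Rg.
have [aa'|/ltnW a'a] := leqP a a';
  first by have [_] := Hg a a' b b' aa' a'd bb' b'c; exact.
by have [_ /(_ Rf)[]] := Hf a' a b b' a'a ad bb' b'c.
Qed.

Lemma minimals_grid j :
  minimals prod_le (grid_points d f g j) = grid_column d f g j.
Proof.
case: (fg) => Hf Hg; apply/seteqP; split=> p.
- case=> -[a [b [ad jb bc ->]]] min; exists a; split=> //.
    exact: leq_ltn_trans jb bc.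
  (* The point with the same index [a] in column [j] lies below, so minimality identifies the
     two. *)
  apply/esym/min; first by exists a, j; split=> //; exact: leq_ltn_trans jb bc.
  by apply/andP; split;
    [apply: (proj1 (Hf _ _ _ _ _ _ _ _))|apply: (proj1 (Hg _ _ _ _ _ _ _ _))].
- case=> a [ad jc ->]; split; first by exists a, j; split.
  move=> q [a' [b [a'd jb bc ->]]] /andP[/= Rf Rg].
  by have [-> ->] := grid_le_eq ad a'd jc jb bc Rf Rg.
Qed.

Lemma grid_rest j :
  shadow_rest prod_le (grid_points d f g 0) j = grid_points d f g j.
Proof.
elim: j => //= j ->; rewrite minimals_grid.
apply/seteqP; split=> p.
- case=> -[a [b [ad jb bc pE]]] ncol; exists a, b; split=> //.
  rewrite ltn_neqAle jb andbT; apply/negP => /eqP jE; apply: ncol.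
  by exists a; rewrite pE jE; split.
- case=> a [b [ad jb bc ->]]; split; first by exists a, b; split=> //;
    exact: ltnW.
  case=> a' [a'd jc [Ef Eg]].
  have [||_ E] := grid_le_eq a'd ad jc (ltnW jb) bc; rewrite ?Ef ?Eg //.
  by move: jb; rewrite E ltnn.
Qed.

Lemma grid_shadow_line j :
  shadow_line prod_le (grid_points d f g 0) j = grid_column d f g j.
Proof. by rewrite /shadow_line grid_rest minimals_grid. Qed.

(* The region above two points of a column is the union of the quadrants above
   the joins of two consecutive ones. *)
Lemma line_skeleton_column j :
  line_skeleton prod_le (grid_column d f g j) =
  grid_column d.-1 f (fun a b => g a.+1 b) j.
Proof.
case: (fg) => Hf Hg; rewrite /line_skeleton; set D := (X in minimals _ X).
(* A point above the entries [a < a'] of the column is above the join of [a] and [a + 1], as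
   ordinates increase with the index. Abscissas decrease, so this join is [(f a j, g a.+1 j)]. *)
have DP p : D p -> exists2 a, a.+1 < d /\ j < c & R (f a j) p.1 /\ R (g a.+1 j)
  p.2.
  case=> _ [_ [[a [ad jc ->]] [a' [a'd _ ->]] ne]] /andP[/= Ra Rb] /andP[/= Ra'
    Rb'].
  have [aa'|a'a|aa'] := ltngtP a a'; last by case: ne; rewrite aa'.
    exists a; first by split=> //; exact: leq_ltn_trans aa' a'd.
    by split=> //; apply: R_trans Rb'; apply: (proj1 (Hg _ _ _ _ _ _ _ _)).
  exists a'; first by split=> //; exact: leq_ltn_trans a'a ad.
  by split=> //; apply: R_trans Rb; apply: (proj1 (Hg _ _ _ _ _ _ _ _)).
have DJ a : a.+1 < d -> j < c -> D (f a j, g a.+1 j).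
  move=> ad jc; have ad' := ltnW ad.
  exists (f a j, g a j), (f a.+1 j, g a.+1 j); split.
  - by exists a.
  - by exists a.+1.
  - case=> _ E; have [_] := Hg a a.+1 j j (leqnSn _) ad (leqnn _) jc.
    by rewrite -E => /(_ (R_refl _))[] /n_Sn.
  - by apply/andP; split; rewrite /= ?R_refl //;
      apply: (proj1 (Hg _ _ _ _ _ _ _ _)).
  - by apply/andP; split; rewrite /= ?R_refl //;
      apply: (proj1 (Hf _ _ _ _ _ _ _ _)).
apply/seteqP; split=> p.
- case=> /DP[a [ad jc] [Ra Rb]] min; exists a; split=> //;
    first by rewrite ltn_predRL.
  by apply/esym/min; [exact: DJ|exact/andP].
- case=> a []; rewrite ltn_predRL => ad jc ->; split; first exact: DJ.
  move=> q /DP[a' [a'd _] [Ra' Rb']] /andP[/= Ra Rb].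
  (* Distinct joins are incomparable: along the column their ordinates increase and their abscissas
     decrease. *)
  have E : a = a'.
    have [aa'|/ltnW a'a] := leqP a a'.
      have [_] := Hg a.+1 a'.+1 j j aa' a'd (leqnn _) jc.
      by move=> /(_ (R_trans Rb' Rb))[[]].
    have [_] := Hf a' a j j a'a (ltnW ad) (leqnn _) jc.
    by move=> /(_ (R_trans Ra' Ra))[].
  by apply: injective_projections; apply: R_anti; rewrite //= E.
Qed.

Lemma skeleton_grid :
  skeleton prod_le (grid_points d f g 0) =
  grid_points d.-1 f (fun a b => g a.+1 b) 0.
Proof.
rewrite /skeleton; apply/seteqP; split=> p.
- by case=> j _; rewrite grid_shadow_line line_skeleton_column => -[a [ad jc
    ->]]; exists a, j.
- case=> a [b [ad _ bc ->]]; exists b => //.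
  by rewrite grid_shadow_line line_skeleton_column; exists a.
Qed.

Lemma grid_mono_next : grid_mono d.-1 f (fun a b => g a.+1 b).
Proof.
case: fg => Hf Hg; split=> a a' b b' aa'; rewrite ltn_predRL => a'd bb' b'c.
  by apply: Hf => //; exact: ltnW.
by have [? H] := Hg a.+1 a'.+1 b b' aa' a'd bb' b'c; split=> // /H[[-> ->]].
Qed.

End Fixed.

Lemma grid_mono_iter d f g k : grid_mono d f g ->
  grid_mono (d - k) f (fun a b => g (k + a) b).
Proof.
move=> fg; elim: k => [|k /grid_mono_next]; first by rewrite subn0.
rewrite -subnS; congr grid_mono; apply/funext => a; apply/funext => b.
by rewrite addSnnS.
Qed.

(** Each skeleton keeps the indices of [f] and shifts those of [g] by one. Truncation in [d - k] is
    harmless: from [k = d] on, the grid is empty. *)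
Lemma iter_skeleton_grid d f g k : grid_mono d f g ->
  iter_skeleton k prod_le (grid_points d f g 0) =
  grid_points (d - k) f (fun a b => g (k + a) b) 0.
Proof.
move=> fg; elim: k => [|k]; first by rewrite subn0.
rewrite /iter_skeleton iterS => ->.
rewrite (skeleton_grid (grid_mono_iter k fg)) -subnS.
by congr grid_points; apply/funext => a; apply/funext => b; rewrite addSnnS.
Qed.

Lemma iter_shadow_line_grid d f g k j : grid_mono d f g ->
  shadow_line prod_le (iter_skeleton k prod_le (grid_points d f g 0)) j =
  grid_column (d - k) f (fun a b => g (k + a) b) j.
Proof.
by move=> fg; rewrite iter_skeleton_grid // grid_shadow_line //;
  exact: grid_mono_iter.
Qed.

Lemma iter_line_skeleton_grid d f g k j : grid_mono d f g ->
  line_skeleton prod_le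
    (shadow_line prod_le (iter_skeleton k prod_le (grid_points d f g 0)) j) =
  shadow_line prod_le (iter_skeleton k.+1 prod_le (grid_points d f g 0)) j.
Proof.
move=> fg; rewrite !iter_shadow_line_grid //.
rewrite (line_skeleton_column (grid_mono_iter k fg)) -subnS.
by congr grid_column; apply/funext => a; apply/funext => b; rewrite addSnnS.
Qed.
End ColumnsAsShadowLines.

(** * Standard tableaux and their lattice words *)

Lemma has_cell_shape T i j : has_cell T (i, j) = (j < nth 0 (shape T) i).
Proof.
rewrite /has_cell /shape /=; case: (ltnP i (size T)) => iT.
  by rewrite (nth_map [::]).
by rewrite !nth_default ?size_map.
Qed.

Lemma has_cell_rect T r c i j : shape T = nseq r c ->
  has_cell T (i, j) = (i < r) && (j < c).
Proof. by move=> sh; rewrite has_cell_shape sh nth_nseq; case: (i < r). Qed.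

Lemma mem_flattenP T x :
  reflect (exists2 p, has_cell T p & entry T p = x) (x \in flatten T).
Proof.
apply: (iffP flattenP) => [[s /(nthP [::])[i iT <-] /(nthP 0)[j js <-]]|].
  by exists (i, j).
case=> -[i j]; rewrite /has_cell /entry /= => ij <-.
exists (nth [::] T i); last exact: mem_nth.
by apply: mem_nth; rewrite ltnNge; apply/negP => iT; rewrite nth_default in ij.
Qed.

Lemma entry_inj T p q : uniq (flatten T) -> has_cell T p -> has_cell T q ->
  entry T p = entry T q -> p = q.
Proof.
elim: T p q => [|s T IH] p q; first by rewrite /has_cell nth_nil.
case: p q => [[|i] j] [[|i'] j'] /=; rewrite cat_uniq.
- move=> /and3P[Us _ _]; rewrite /has_cell /entry /= => js j's /eqP.
  by rewrite nth_uniq // => /eqP ->.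
- move=> /and3P[_ /hasPn D _] js j's E.
  have : entry T (i', j') \in flatten T by apply/mem_flattenP; exists (i', j').
  by move=> /D; rewrite /= -[entry T _]E mem_nth.
- move=> /and3P[_ /hasPn D _] js j's E.
  have : entry T (i, j) \in flatten T by apply/mem_flattenP; exists (i, j).
  by move=> /D; rewrite /= [entry T _]E mem_nth.
- by move=> /and3P[_ _ U] ij ij' E;
    have [-> ->] := IH (i, j) (i', j') U ij ij' E.
Qed.

(** Pointwise form of [is_SYT], with the permutation condition split into range, surjectivity and
    injectivity of [entry]. *)
Record standard (r c : nat) (T : tableau) : Prop := Standard {
  std_shape : shape T = nseq r c;
  std_bound : forall i j, i < r -> j < c -> 0 < entry T (i, j) <= r * c;
  std_surj : forall y, 0 < y <= r * c ->
    exists i j, [/\ i < r, j < c & entry T (i, j) = y];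
  std_inj : forall i j i' j', i < r -> j < c -> i' < r -> j' < c ->
    entry T (i, j) = entry T (i', j') -> i = i' /\ j = j';
  std_row : forall i j, i < r -> j.+1 < c -> entry T (i, j) < entry T (i, j.+1);
  std_col : forall i j, i.+1 < r -> j < c ->
    entry T (i, j) < entry T (i.+1, j) }.

Lemma is_SYT_standard r c T : is_SYT r c T -> standard r c T.
Proof.
case=> sh pe row col;
  have U : uniq (flatten T) by rewrite (perm_uniq pe) iota_uniq.
have hc i j := has_cell_rect i j sh.
have memE x : (x \in flatten T) = (0 < x <= r * c).
  by rewrite (perm_mem pe) mem_iota add1n ltnS.
split=> //.
- move=> i j ir jc; rewrite -memE; apply/mem_flattenP; exists (i, j) => //.
  by rewrite hc ir.
- move=> y; rewrite -memE => /mem_flattenP[[i j]]; rewrite hc => /andP[ir jc] E.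
  by exists i, j.
- move=> i j i' j' ir jc ir' jc' E.
  by have [-> ->] : (i, j) = (i', j') by apply: (entry_inj U);
    rewrite ?hc ?ir ?ir'.
Qed.

(** Each unit step right or down raises the entry by at least one, so the reverse inequality leaves
    room for no step. *)
Lemma standard_mono r c T i j i' j' : standard r c T ->
  i <= i' -> i' < r -> j <= j' -> j' < c ->
  entry T (i, j) <= entry T (i', j') /\
  (entry T (i', j') <= entry T (i, j) -> i = i' /\ j = j').
Proof.
move=> std ii' i'r jj' j'c.
have row k : j + k < c -> entry T (i, j) + k <= entry T (i, j + k).
  elim: k => [|k IH] jk; first by rewrite !addn0.
  rewrite addnS in jk *; have := IH (ltnW jk);
    have := @std_row _ _ _ std i (j + k).
  by rewrite addnS => /(_ (leq_ltn_trans ii' i'r) jk); lia.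
have col k : i + k < r -> entry T (i, j') + k <= entry T (i + k, j').
  elim: k => [|k IH] ik; first by rewrite !addn0.
  rewrite addnS in ik *; have := IH (ltnW ik);
    have := @std_col _ _ _ std (i + k) j'.
  by rewrite addnS => /(_ ik j'c); lia.
have := row (j' - j); have := col (i' - i); rewrite !subnKC //; lia.
Qed.

Lemma standard_size r c T : standard r c T -> size T = r.
Proof.
by move=> std; rewrite -(size_map size) -/(shape T) (std_shape std) size_nseq.
Qed.

Lemma tableau_of_wordE r c T w : 0 < r -> 0 < c -> standard r c T ->
  size w = r * c ->
  (forall i j, i < r -> j < c -> nth 0 w (entry T (i, j)).-1 = i.+1) ->
  tableau_of_word w = T.
Proof.
move=> r0 c0 std sw wE.
have szT := standard_size std.
have szrow i : i < r -> size (nth [::] T i) = c.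
  move=> ir; rewrite -(nth_map _ 0) ?szT // -/(shape T) (std_shape std) nth_nseq
    ir //.
(* The letter [r] occurs because the last row is nonempty, [c] being positive; this gives the right
   number of rows. *)
have wr : \max_(x <- w) x = r.
  apply/eqP; rewrite eqn_leq; apply/andP; split.
    apply/bigmax_leqP_seq => x /(nthP 0)[k]; rewrite sw => kn <- _.
    by have [i [j [ir jc E]]] := @std_surj _ _ _ std k.+1 kn;
      have := wE i j ir jc; rewrite E /= => ->.
  have r1 : r.-1 < r by lia.
  have /andP[e0 en] := std_bound std r1 c0.
  have := wE _ _ r1 c0; rewrite prednK // => <-.
  by apply: leq_bigmax_seq => //; rewrite mem_nth // sw; lia.
rewrite /tableau_of_word wr sw.
apply: (@eq_from_nth _ [::]); rewrite size_map size_iota ?szT // => i ir.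
rewrite (nth_map 0) ?size_iota // nth_iota // add1n.
(* Both rows are strictly increasing, so it suffices that they have the same elements. *)
apply: (@irr_sorted_eq _ ltn ltn_trans ltnn).
- by apply: sorted_filter; [exact: ltn_trans|exact: iota_ltn_sorted].
- apply/(sortedP 0) => j jc; rewrite szrow // in jc.
  exact: (std_row std ir jc).
- move=> x; rewrite mem_filter mem_iota add1n ltnS.
  apply/andP/(nthP 0) => [[/eqP wx /(std_surj std)[i' [j [i'r jc E]]]]|[j]].
    have [ii'] : i.+1 = i'.+1 by rewrite -wx -E wE.
    by exists j; rewrite ?szrow // ii'.
  rewrite szrow // => jc <-; split; last exact: std_bound.
  by apply/eqP; exact: wE.
Qed.

Lemma labelE A p l : (forall l', has_label A p l' <-> l' = l) -> label A p = l.
Proof.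
move=> H; apply: xget_unique => // l' H'.
by apply/H; apply/H'.
Qed.

(** * Viennot's construction on the grid of two standard tableaux *)

Section TwoStandardTableaux.

Variables (r c : nat) (Q E : tableau).
Hypotheses (std_Q : standard r c Q) (std_E : standard r c E).

(** For [a < r] and [b < c] both pairs of coordinates list the same points. The second reverses rows
    and columns, which makes it monotone for the reversed order. *)
Definition ne_abscissa (a b : nat) : int := entry Q (r.-1 - a, b).
Definition ne_ordinate (a b : nat) : int := entry E (a, b).
Definition sw_abscissa (a b : nat) : int := entry Q (a, c.-1 - b).
Definition sw_ordinate (a b : nat) : int := entry E (r.-1 - a, c.-1 - b).

Lemma ne_grid_mono :
  grid_mono (fun x y => (x <= y)%R) c r ne_abscissa ne_ordinate.
Proof.
split=> a a' b b' aa' a'r bb' b'c; rewrite /ne_abscissa /ne_ordinate.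
  have := @standard_mono _ _ _ (r.-1 - a') b (r.-1 - a) b' std_Q; lia.
have := @standard_mono _ _ _ a b a' b' std_E; lia.
Qed.

Lemma sw_grid_mono :
  grid_mono (fun x y => (y <= x)%R) c r sw_abscissa sw_ordinate.
Proof.
split=> a a' b b' aa' a'r bb' b'c; rewrite /sw_abscissa /sw_ordinate.
  have := @standard_mono _ _ _ a (c.-1 - b') a' (c.-1 - b) std_Q; lia.
have := @standard_mono _ _ _ (r.-1 - a') (c.-1 - b') (r.-1 - a) (c.-1 - b)
  std_E; lia.
Qed.

Notation A := (grid_points c r ne_abscissa ne_ordinate 0).

Lemma ne_iter_shadow_line i j :
  shadow_line ne_le (iter_skeleton i ne_le A) j =
  grid_column c (r - i) ne_abscissa (fun a b => ne_ordinate (i + a) b) j.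
Proof. by apply: iter_shadow_line_grid ne_grid_mono; lia. Qed.

(** All abscissas are at most [r * c], so on this edge only ordinates count: the line leaves at the
    smallest ordinate of its column, which after [i] skeletons has index [i]. *)
Lemma right_drawn_line i j y :
  drawn_line (shadow_line ne_le (iter_skeleton i ne_le A) j)
    (((r * c).+1)%:Z, y%:Z)%R <->
  [/\ i < r, j < c & entry E (i, j) = y].
Proof.
rewrite ne_iter_shadow_line; split=> [[]|].
- case=> _ [a [ai jc ->]] /andP[/= _ Ey] nsh; have ir : i < r by lia.
  split=> //; have := @standard_mono _ _ _ i j (i + a) j std_E.
  rewrite /ne_ordinate in Ey.
  suff : ~ (entry E (i, j) <= y.-1 /\ 0 < y) by have := std_bound std_E ir jc;
    lia.
  case=> Ey' y0; apply: nsh.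
  (* The diagonal predecessor has abscissa [r * c], still to the right of all points of the line. *)
  exists (ne_abscissa 0 j, ne_ordinate (i + 0) j); first by exists 0;
    split=> //; lia.
  have := @std_bound _ _ _ std_Q (r.-1 - 0) j.
  by rewrite addn0 /ne_le /ne_abscissa /ne_ordinate /=; lia.
- case=> ir jc <-; split.
    exists (ne_abscissa 0 j, ne_ordinate (i + 0) j); first by exists 0;
      split=> //; lia.
    have := @std_bound _ _ _ std_Q (r.-1 - 0) j.
    by rewrite addn0 /ne_le /ne_abscissa /ne_ordinate /=; lia.
  case=> _ [a [ai _ ->]] /andP[/= _]; rewrite /ne_ordinate.
  by have := @standard_mono _ _ _ i j (i + a) j std_E; lia.
Qed.

Lemma top_drawn_line i j x :
  drawn_line (shadow_line ne_le (iter_skeleton i ne_le A) j)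
    (x%:Z, ((r * c).+1)%:Z)%R <->
  [/\ i < r, j < c & entry Q (i, j) = x].
Proof.
rewrite ne_iter_shadow_line.
(* The leftmost point of the line has index [a = r - 1 - i], hence ordinate index
   [i + a = r - 1]. *)
have low : i < r -> j < c ->
    grid_column c (r - i) ne_abscissa (fun a b => ne_ordinate (i + a) b) j
      ((entry Q (i, j))%:Z, (entry E (r.-1, j))%:Z)%R.
  move=> ir jc; exists (r.-1 - i); rewrite /ne_abscissa /ne_ordinate;
    split=> //; first lia.
  by congr (Posz (entry _ (_, _)), Posz (entry _ (_, _))); lia.
split=> [[]|].
- case=> _ [a [ai jc ->]] /andP[/= Qx _] nsh; have ir : i < r by lia.
  split=> //; have := @standard_mono _ _ _ i j (r.-1 - a) j std_Q.
  rewrite /ne_abscissa in Qx.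
  suff : ~ (entry Q (i, j) <= x.-1 /\ 0 < x) by have := std_bound std_Q ir jc;
    lia.
  case=> Qx' x0; apply: nsh;
    exists ((entry Q (i, j))%:Z, (entry E (r.-1, j))%:Z)%R.
    exact: low.
  by have := @std_bound _ _ _ std_E r.-1 j; rewrite /ne_le /=; lia.
- case=> ir jc <-; split.
    exists ((entry Q (i, j))%:Z, (entry E (r.-1, j))%:Z)%R; first exact: low.
    by have := @std_bound _ _ _ std_E r.-1 j; rewrite /ne_le /=; lia.
  case=> _ [a [ai _ ->]] /andP[/= + _]; rewrite /ne_abscissa.
  by have := @standard_mono _ _ _ i j (r.-1 - a) j std_Q; lia.
Qed.

Lemma right_label i j : i < r -> j < c ->
  label A (((r * c).+1)%:Z, (entry E (i, j))%:Z)%R = i.+1.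
Proof.
move=> ir jc; apply: labelE => l; split.
  case=> i' [j' [-> /right_drawn_line[ir' jc' /(std_inj std_E)]]].
  by case=> // ->.
by move=> ->; exists i, j; split=> //; apply/right_drawn_line.
Qed.

Lemma top_label i j : i < r -> j < c ->
  label A ((entry Q (i, j))%:Z, ((r * c).+1)%:Z)%R = i.+1.
Proof.
move=> ir jc; apply: labelE => l; split.
  case=> i' [j' [-> /top_drawn_line[ir' jc' /(std_inj std_Q)]]].
  by case=> // ->.
by move=> ->; exists i, j; split=> //; apply/top_drawn_line.
Qed.

Lemma viennot_grid : 0 < r -> 0 < c -> viennot (r * c) A = (E, Q).
Proof.
move=> r0 c0; congr (_, _); apply: tableau_of_wordE r0 c0 _ _ _ => //.
- by rewrite size_map size_iota.
- move=> i j ir jc; have /andP[e0 en] := std_bound std_E ir jc.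
  rewrite (nth_map 0) ?size_iota ?prednK // nth_iota ?prednK // add1n prednK //.
  exact: right_label.
- by rewrite size_map size_iota.
- move=> i j ir jc; have /andP[e0 en] := std_bound std_Q ir jc.
  rewrite (nth_map 0) ?size_iota ?prednK // nth_iota ?prednK // add1n prednK //.
  exact: top_label.
Qed.

End TwoStandardTableaux.

(** * Jeu de taquin slides and evacuation *)

Lemma has_cellS T i j : has_cell T (i, j.+1) -> has_cell T (i, j).
Proof. by rewrite /has_cell /=; exact: ltnW. Qed.

Lemma has_cell_eq_shape T U p : shape T = shape U ->
  has_cell T p = has_cell U p.
Proof. by case: p => i j E; rewrite !has_cell_shape E. Qed.

Lemma entry_set_entry T p v q :
  entry (set_entry T p v) q = if q == p then v else entry T q.
Proof.
case: p q => [i j] [i' j'];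
  rewrite /entry /set_entry nth_set_nth /= -pair_eqE /=.
by case: (i' =P i) => [->|_] //=; rewrite nth_set_nth /=.
Qed.

Lemma shape_set_entry T p v : has_cell T p -> shape (set_entry T p v) = shape T.
Proof.
case: p => i j; rewrite /has_cell /set_entry /= => ij.
have iT : i < size T.
  by rewrite ltnNge; apply/negP => iT; rewrite nth_default in ij.
apply: (@eq_from_nth _ 0); rewrite !size_map ?size_set_nth ?(maxn_idPr iT) //.
move=> k kT; rewrite !(nth_map [::]) ?size_set_nth ?(maxn_idPr iT) //.
rewrite nth_set_nth /=; case: (k =P i) => // ->.
by rewrite size_set_nth (maxn_idPr ij).
Qed.

Lemma has_cell_drop_cell T i j q : has_cell T (i, j) ->
  ~~ has_cell T (i, j.+1) ->
  has_cell (drop_cell T (i, j)) q = has_cell T q && (q != (i, j)).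
Proof.
case: q => i' j'; rewrite /has_cell /drop_cell nth_set_nth /= -pair_eqE /=.
case: (i' =P i) => [->|_] ij nij /=; last by rewrite andbT.
by rewrite size_takel; lia.
Qed.

Lemma entry_drop_cell T p q : has_cell (drop_cell T p) q ->
  entry (drop_cell T p) q = entry T q.
Proof.
case: p q => i j [i' j']; rewrite /has_cell /entry /drop_cell nth_set_nth /=.
by case: (i' =P i) => [->|_] //=; rewrite size_take_min leq_min => /andP[H _];
  rewrite nth_take.
Qed.

(** Rows are lists, hence left-justified; this column condition alone makes the shape a Young
    diagram. *)
Definition straight (T : tableau) : Prop :=
  forall i j, has_cell T (i.+1, j) -> has_cell T (i, j).

(** The cells to the left of [p] and the first cells of the rows above are [p.1 + p.2] cells other
    than [p]. *)
Lemma has_cell_lt_size T p : straight T -> has_cell T p ->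
  p.1 + p.2 < size (flatten T).
Proof.
elim: T p => [|s T IH] [i j] st /=; first by rewrite /has_cell nth_nil.
rewrite size_cat; case: i => [|i] ij; first by rewrite /has_cell /= in ij; lia.
have s0 : 0 < size s.
  have : has_cell (s :: T) (i.+1, 0) by rewrite /has_cell /= in ij *; lia.
  by elim: i.+1 => [|k IHk] // /st.
have := IH (i, j) (fun i j => st i.+1 j) ij; rewrite /=; lia.
Qed.

Definition jdt_step (T : tableau) : rel cell :=
  fun p q => jdt_next T p == Some q.

Lemma jdt_stepP T p q : jdt_step T p q ->
  has_cell T q /\ (q = (p.1, p.2.+1) \/ q = (p.1.+1, p.2)).
Proof.
rewrite /jdt_step /jdt_next; case: ifP => [hr|_]; last first.
  by case: ifP => // hb /eqP[<-]; split=> //; right.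
by case: ifP => [/andP[hb _] /eqP[<-]|_ /eqP[<-]]; split=> //; [right|left].
Qed.

Lemma jdt_next_none T i j : jdt_next T (i, j) = None <->
  ~~ has_cell T (i, j.+1) /\ ~~ has_cell T (i.+1, j).
Proof.
rewrite /jdt_next /=; case: (has_cell T (i, j.+1)); first by case: ifP;
  split=> // -[].
by case: ifP; split=> // -[].
Qed.

(** The coordinate sum grows by one at each step and stays below the number of cells, so the path
    stops at a corner before the fuel runs out. *)
Lemma jdt_path_recE T fuel p : straight T -> has_cell T p ->
  size (flatten T) <= fuel + (p.1 + p.2) ->
  exists s, [/\ jdt_path_rec fuel T p = p :: s, path (jdt_step T) p s
    & jdt_next T (last p s) = None].
Proof.
move=> st; elim: fuel p => [|fuel IH] p hp szT.
  by have := has_cell_lt_size st hp; rewrite ltnNge szT.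
rewrite /=; case E: (jdt_next T p) => [q|]; last by exists [::].
have pq : jdt_step T p q by rewrite /jdt_step E.
have [hq qE] := jdt_stepP pq.
have [|s [-> ps ls]] := IH q hq; first by case: qE szT => ->; rewrite /=; lia.
by exists (q :: s); split=> //=; rewrite pq.
Qed.

Lemma jdt_pathE T : straight T -> has_cell T (0, 0) ->
  exists s, [/\ jdt_path T = (0, 0) :: s, path (jdt_step T) (0, 0) s
    & jdt_next T (last (0, 0) s) = None].
Proof. by move=> st h0; apply: jdt_path_recE; rewrite ?addn0. Qed.

(** [jdt_step] is a partial function, so every path is a prefix of a path from the same start that
    cannot be continued. *)
Lemma path_jdt_unique T p s1 s2 :
  path (jdt_step T) p s1 -> path (jdt_step T) p s2 ->
  jdt_next T (last p s2) = None -> exists u, s2 = s1 ++ u.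
Proof.
elim: s1 p s2 => [|q s1 IH] p s2 /=; first by exists s2.
case: s2 => [|q2 s2] /=; first by case/andP=> /eqP ->.
case/andP=> /eqP E ps1 /andP[]; rewrite /jdt_step E => /eqP[<-] ps2 ls2.
by have [u ->] := IH _ _ ps1 ps2 ls2; exists u.
Qed.

Lemma path_jdt_has_cell T p s : has_cell T p -> path (jdt_step T) p s ->
  {in p :: s, forall q, has_cell T q}.
Proof.
elim: s p => [|q s IH] p hp /=; first by move=> _ x; rewrite inE => /eqP ->.
case/andP=> /jdt_stepP[hq _] /(IH _ hq) H x; rewrite inE => /orP[/eqP -> //|].
exact: H.
Qed.

Lemma path_jdt_ge T p s : path (jdt_step T) p s ->
  {in s, forall q, [/\ p.1 <= q.1, p.2 <= q.2 & p.1 + p.2 < q.1 + q.2]}.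
Proof.
elim: s p => //= q s IH p /andP[/jdt_stepP[_ qE] /IH H] x; rewrite inE.
case/orP => [/eqP ->|/H[]]; case: qE => -> /=; split; lia.
Qed.

Lemma path_jdt_next T p s q : path (jdt_step T) p s -> q \in belast p s ->
  exists2 q', q' \in s & jdt_next T q = Some q'.
Proof.
elim: s p => //= q1 s IH p /andP[/eqP E ps]; rewrite inE => /orP[/eqP ->|].
  by exists q1; rewrite ?mem_head.
by case/(IH _ ps) => q' q's ->; exists q' => //; rewrite inE q's orbT.
Qed.

(* No distinctness of the cells of the path is needed: the value written in a
   cell depends on that cell only. *)
Lemma entry_foldl_slide T U p s q : path (jdt_step T) p s ->
  entry (foldl (fun U m => set_entry U m.1 (entry T m.2)) U (zip (p :: s) s)) q
    =
  if q \in belast p s then oapp (entry T) 0 (jdt_next T q) else entry U q.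
Proof.
elim: s p U => //= q1 s IH p U /andP[/eqP E ps].
rewrite IH // entry_set_entry inE; case: ifP => qs; first by rewrite orbT.
by rewrite orbF; case: (q =P p) => [->|] //; rewrite E.
Qed.

Lemma shape_foldl_slide T U p s : {in p :: s, forall q, has_cell U q} ->
  shape (foldl (fun U m => set_entry U m.1 (entry T m.2)) U (zip (p :: s) s)) =
  shape U.
Proof.
elim: s p U => //= q1 s IH p U H.
have hp : has_cell U p by apply: H; rewrite mem_head.
have sh : shape (set_entry U p (entry T q1)) = shape U by exact:
  shape_set_entry.
rewrite IH // => q qs.
by rewrite (has_cell_eq_shape _ sh); apply: H; rewrite inE qs orbT.
Qed.

Section Slide.

Variables (T : tableau) (s : seq cell).
Hypotheses (T0 : has_cell T (0, 0)) (TE : jdt_path T = (0, 0) :: s)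
  (Ts : path (jdt_step T) (0, 0) s).

Lemma jdt_movesE : jdt_moves T = zip ((0, 0) :: s) s.
Proof. by rewrite /jdt_moves TE. Qed.

Lemma jdt_endE : jdt_end T = last (0, 0) s.
Proof. by rewrite /jdt_end TE. Qed.

Lemma entry_jdt_slide q : entry (jdt_slide T) q =
  if q \in belast (0, 0) s then oapp (entry T) 0 (jdt_next T q) else entry T q.
Proof. by rewrite /jdt_slide jdt_movesE entry_foldl_slide. Qed.

Lemma shape_jdt_slide : shape (jdt_slide T) = shape T.
Proof.
by rewrite /jdt_slide jdt_movesE shape_foldl_slide //;
  exact: path_jdt_has_cell Ts.
Qed.

Lemma has_cell_jdt_slide q : has_cell (jdt_slide T) q = has_cell T q.
Proof. exact: has_cell_eq_shape shape_jdt_slide. Qed.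

Lemma has_cell_jdt_end : has_cell T (jdt_end T).
Proof.
by rewrite jdt_endE; apply: (path_jdt_has_cell T0 Ts); exact: mem_last.
Qed.

End Slide.

(** * Entries written by evacuation *)

Definition evacuation_step (T : tableau) : tableau :=
  drop_cell (jdt_slide T) (jdt_end T).

Lemma entry_evacuation_rec_out m T U p :
  (forall k, k < m -> p <> jdt_end (iter k evacuation_step T)) ->
  entry (evacuation_rec m T U) p = entry U p.
Proof.
elim: m T U => //= m IH T U H; rewrite -/(evacuation_step T) IH.
  by rewrite entry_set_entry; case: eqP => // E; case: (H 0).
by move=> k km; have := H k.+1 km; rewrite iterSr.
Qed.

(** The last hypothesis excludes later overwriting; it will follow from the vacated cells being
    distinct. *)
Lemma entry_evacuation_rec m T U p k : k < m ->
  p = jdt_end (iter k evacuation_step T) ->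
  (forall l, k < l < m -> p <> jdt_end (iter l evacuation_step T)) ->
  entry (evacuation_rec m T U) p = m - k.
Proof.
elim: m T U k => //= m IH T U [|k] km pE H; rewrite -/(evacuation_step T).
  rewrite entry_evacuation_rec_out ?entry_set_entry ?pE ?eqxx //= => l lm.
  by have := H l.+1 lm; rewrite iterSr pE.
rewrite (IH _ _ k) //; first by rewrite pE iterSr.
by move=> l lm; have := H l.+1 lm; rewrite iterSr.
Qed.

Lemma shape_evacuation_rec m T U :
  (forall k, k < m -> has_cell U (jdt_end (iter k evacuation_step T))) ->
  shape (evacuation_rec m T U) = shape U.
Proof.
elim: m T U => //= m IH T U H; rewrite -/(evacuation_step T).
have sh : shape (set_entry U (jdt_end T) m.+1) = shape U.
  by apply: shape_set_entry; exact: (H 0).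
rewrite IH // => k km; rewrite (has_cell_eq_shape _ sh) -iterSr.
exact: (H k.+1).
Qed.

(** A move raises the row index by 0 or 1, so a path crosses from row [i] to row [i + 1] once if
    these levels separate its ends, and never otherwise. *)
Lemma slide_segment T i p s : path (jdt_step T) p s ->
  let moves := [seq m <- zip (p :: s) s | (m.1.1 == i) && (m.2.1 == i.+1)] in
  if p.1 <= i < (last p s).1
  then exists q, [/\ q \in s, q.1 = i.+1 & [seq entry T m.2 | m <- moves] = [::
    entry T q]]
  else moves = [::].
Proof.
elim: s p => [|q s IH] p /=; first by case: ifP => //; lia.
case/andP=> pq ps; have [hq qE] := jdt_stepP pq; have := IH q ps.
have ge : q.1 <= (last q s).1.
  have := mem_last q s; rewrite inE => /orP[/eqP -> //|].
  by case/(path_jdt_ge ps).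
case: qE => qE.
  have -> : q.1 = p.1 by rewrite qE.
  have -> : (p.1 == i) && (p.1 == i.+1) = false by lia.
  case: ifP => // _ [q' [q's q'i ->]]; exists q'; split=> //.
  by rewrite inE q's orbT.
have q1 : q.1 = p.1.+1 by rewrite qE.
rewrite q1 eqSS andbb; case: (p.1 =P i) => pi.
  rewrite -pi ltnn leqnn -q1 ge /= => ->; exists q; split=> //.
  by rewrite mem_head.
have -> : (p.1 <= i < (last q s).1) = (p.1 < i < (last q s).1) by lia.
case: ifP => // _ [q' [q's q'i ->]]; exists q'; split=> //.
by rewrite inE q's orbT.
Qed.

(** * Gromotion of a stacked tableau *)

Lemma zip_path_cat (p : cell) s1 s2 :
  zip (p :: s1 ++ s2) (s1 ++ s2) = zip (p :: s1) s1 ++ zip (last p s1 :: s2) s2.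
Proof. by elim: s1 p => //= q s1 IH p; rewrite -IH. Qed.

Section Gromotion.

Variables (r c : nat) (Q : tableau).
Hypotheses (r_gt0 : 0 < r) (c_gt0 : 0 < c) (std_Q : standard r c Q).

Let n := r * c.

(* [U] is [P] after [m] steps of its evacuation, [T] is the m-th gromotion of
   [stack n P Q], and [h j] is the height of column [j] of [U].  Column [j] of
   [T] is that of [U], followed by that of [Q] and then by new entries. *)
Record gromotion_inv (m : nat) (U T : tableau) (h : nat -> nat) : Prop := GInv {
  inv_U : forall i j, has_cell U (i, j) = (j < c) && (i < h j);
  inv_h : forall j, j < c -> h j <= r;
  inv_sum : \sum_(j < c) h j = n - m;
  inv_T : shape T = nseq (r + r) c;
  inv_low : forall i j, j < c -> i < h j ->
    entry T (i, j) = entry U (i, j) /\ entry U (i, j) <= n;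
  inv_mid : forall k j, j < c -> k < r ->
    entry T (h j + k, j) = n + entry Q (k, j);
  inv_high : forall i j, j < c -> h j + r <= i -> i < r + r ->
    n + n < entry T (i, j) <= n + n + m }.

(** If (a, b) is the lowest cell of column [b] of [U], these cells of [T] hold column [b] of [Q]. *)
Definition cells_below (a b : nat) : seq cell :=
  [seq (a + k, b) | k <- iota 1 r].

Lemma mem_cells_below a b i j :
  ((i, j) \in cells_below a b) = (j == b) && (a < i <= a + r).
Proof.
apply/mapP/andP => [[k]|[/eqP-> ai]].
  by rewrite mem_iota => kr [-> ->]; split=> //; lia.
by exists (i - a); [rewrite mem_iota; lia|congr (_, _); lia].
Qed.

Lemma last_cells_below p a b : last p (cells_below a b) = (a + r, b).
Proof.
rewrite /cells_below; have -> : r = r.-1 + 1 by lia.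
rewrite iotaD map_cat last_cat /=; congr (_, _); lia.
Qed.

Lemma mem_belast_below a b i j :
  ((i, j) \in belast (a, b) (cells_below a b)) = (j == b) && (a <= i < a + r).
Proof.
have -> : belast (a, b) (cells_below a b) = [seq (a + k, b) | k <- iota 0 r].
  rewrite /cells_below -{1}[a]addn0; elim: r 0 => //= k IH x.
  by congr (_ :: _); exact: IH.
apply/mapP/andP => [[k]|[/eqP-> ai]].
  by rewrite mem_iota => kr [-> ->]; split=> //; lia.
by exists (i - a); [rewrite mem_iota; lia|congr (_, _); lia].
Qed.

Section Step.

Variables (m : nat) (U T : tableau) (h : nat -> nat).
Hypotheses (m_lt : m < n) (inv : gromotion_inv m U T h).

Lemma inv_cell_T i j : has_cell T (i, j) = (i < r + r) && (j < c).
Proof. exact: has_cell_rect (inv_T inv). Qed.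

Lemma inv_h_mono j j' : j <= j' -> j' < c -> h j' <= h j.
Proof.
move=> jj' j'c; case E: (h j') => [//|i].
have : has_cell U (i, j') by rewrite (inv_U inv) j'c E ltnSn.
have -> : j' = j + (j' - j) by lia.
elim: (j' - j) => [|k IH]; last by rewrite addnS => /has_cellS.
by rewrite addn0 (inv_U inv) => /andP[].
Qed.

Lemma inv_h0_gt0 : 0 < h 0.
Proof.
rewrite lt0n; apply/eqP => h0.
have := inv_sum inv; rewrite big1 => [|j _]; first by move=> E; move: m_lt; lia.
by apply/eqP; rewrite -leqn0 -h0; exact: inv_h_mono.
Qed.

Lemma inv_straight_U : straight U.
Proof. by move=> i j; rewrite !(inv_U inv) => /andP[-> /ltnW]. Qed.

Lemma inv_straight_T : straight T.
Proof. by move=> i j; rewrite !inv_cell_T => /andP[/ltnW -> ->]. Qed.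

Lemma inv_U0 : has_cell U (0, 0).
Proof. by rewrite (inv_U inv) c_gt0 inv_h0_gt0. Qed.

Lemma inv_T0 : has_cell T (0, 0).
Proof. by rewrite inv_cell_T c_gt0 addn_gt0 r_gt0. Qed.

Lemma inv_gt_n i j : has_cell T (i, j) -> ~~ has_cell U (i, j) ->
  n < entry T (i, j).
Proof.
rewrite inv_cell_T (inv_U inv) => /andP[irr jc]; rewrite jc /= -leqNgt => hi.
have [hri|] := leqP (h j + r) i.
  by have := inv_high inv jc hri irr; lia.
rewrite -ltn_subLR // => kr; have := inv_mid inv jc kr; rewrite subnKC // => ->.
by have := std_bound std_Q kr jc; lia.
Qed.

(** Entries of [T] are at most [n] on the cells of [U] and larger elsewhere, so a competitor from
    outside [U] never wins. *)
Lemma inv_jdt_next p q : has_cell U p -> jdt_next U p = Some q ->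
  jdt_next T p = Some q.
Proof.
case: p => i j hU; have := hU; rewrite (inv_U inv) => /andP[jc ih].
have hr := inv_h inv jc.
have sub q' : has_cell U q' -> has_cell T q' /\ entry T q' = entry U q'.
  case: q' => i' j'; rewrite (inv_U inv) inv_cell_T => /andP[j'c ih'].
  by have [] := inv_low inv j'c ih'; have := inv_h inv j'c; rewrite j'c;
    split=> //; lia.
have small q' : has_cell U q' -> entry T q' <= n.
  case: q' => i' j'; rewrite (inv_U inv) => /andP[j'c ih'].
  by have [->] := inv_low inv j'c ih'.
rewrite /jdt_next /=.
case: (boolP (has_cell U (i, j.+1))) => R;
  case: (boolP (has_cell U (i.+1, j))) => B //=.
- by have [-> ->] := sub _ R; have [-> ->] := sub _ B.
- have [-> _] := sub _ R; move=> [<-]; case: ifP => // /andP[hB lt]; exfalso.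
  by move: lt; have := inv_gt_n hB B; have := small _ R; lia.
- have [-> _] := sub _ B; move=> [<-]; case: ifP => // hR.
  suff -> : entry T (i.+1, j) < entry T (i, j.+1) by [].
  by have := inv_gt_n hR R; have := small _ B; lia.
Qed.

Lemma inv_path_U p s : has_cell U p -> path (jdt_step U) p s ->
  path (jdt_step T) p s.
Proof.
elim: s p => //= q s IH p hp /andP[/[dup] pq /eqP/(inv_jdt_next hp) E ps].
by rewrite /jdt_step E eqxx /=; apply: IH ps; have [] := jdt_stepP pq.
Qed.

Section End.

Variables a b : nat.
Hypotheses (b_lt : b < c) (hb : h b = a.+1) (hb1 : b.+1 < c -> h b.+1 <= a).

(* The corner condition on (a, b) puts the entry Q (k, b) below the hole against
   Q (k', b + 1) with k <= k', or a new entry, on its right. *)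
Lemma inv_next_below k : k < r -> jdt_next T (a + k, b) = Some (a + k.+1, b).
Proof.
move=> kr; have ar : a < r by rewrite -hb; exact: (inv_h inv).
rewrite /jdt_next /= -addnS.
have hB : has_cell T (a + k.+1, b) by rewrite inv_cell_T b_lt andbT; lia.
rewrite hB; case: ifP => // hR.
suff -> : entry T (a + k.+1, b) < entry T (a + k, b.+1) by [].
have -> : a + k.+1 = h b + k by rewrite hb; lia.
rewrite (inv_mid inv) //; move: hR; rewrite inv_cell_T => /andP[akr b1c].
have h1 := hb1 b1c; have Qk := std_bound std_Q kr b_lt.
have [hi|] := leqP (h b.+1 + r) (a + k).
  by have := inv_high inv b1c hi akr; rewrite -/n in Qk *; lia.
have h1k : h b.+1 <= a + k by lia.
rewrite -ltn_subLR // => k'r; have := inv_mid inv b1c k'r;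
  rewrite subnKC // => ->.
by have := @standard_mono _ _ _ k b (a + k - h b.+1) b.+1 std_Q; lia.
Qed.

Lemma inv_path_below : path (jdt_step T) (a, b) (cells_below a b).
Proof.
apply/(pathP (0, 0)) => k; rewrite /cells_below size_map size_iota => kr.
rewrite (nth_map 0) ?size_iota // nth_iota // add1n.
suff -> : nth (0, 0) ((a, b) :: cells_below a b) k = (a + k, b).
  by rewrite /jdt_step inv_next_below.
case: k kr => [|k] kr /=; first by rewrite addn0.
by rewrite /cells_below (nth_map 0) ?size_iota 1?ltnW // nth_iota 1?ltnW //
  add1n.
Qed.

End End.

(** The path in [T] has three stretches: [s] inside [U], a vertical run through column [b] of [Q],
    and [u] among the new entries, down to the last cell of the rectangle. *)
Lemma inv_pathP : exists s u a b,
  [/\ [/\ jdt_path U = (0, 0) :: s, path (jdt_step U) (0, 0) s & last (0, 0) s =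
    (a, b)],
      [/\ b < c, h b = a.+1 & b.+1 < c -> h b.+1 <= a],
      jdt_path T = (0, 0) :: s ++ cells_below a b ++ u,
      [/\ path (jdt_step T) (0, 0) s, path (jdt_step T) (a, b) (cells_below a b)
        & path (jdt_step T) (a + r, b) u]
    & last (a + r, b) u = ((r + r).-1, c.-1)].
Proof.
have [s [sE ps ns]] := jdt_pathE inv_straight_U inv_U0.
have [t [tE pt nt]] := jdt_pathE inv_straight_T inv_T0.
case E: (last (0, 0) s) ns => [a b] /jdt_next_none.
rewrite !(inv_U inv) => -[nr nb].
have : has_cell U (a, b).
  by rewrite -E; apply: (path_jdt_has_cell inv_U0 ps); exact: mem_last.
rewrite (inv_U inv) => /andP[bc ab].
have hb : h b = a.+1 by lia.
have hb1 : b.+1 < c -> h b.+1 <= a by lia.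
have psT := inv_path_U inv_U0 ps.
have pbT := inv_path_below bc hb hb1.
(* The first two stretches form a path in [T], hence by determinism a prefix of the full one. *)
have [|v vE] := path_jdt_unique _ pt nt (s1 := s ++ cells_below a b).
  by rewrite cat_path psT E.
have := pt; rewrite vE !cat_path !last_cat E last_cells_below => /andP[_ pv].
exists s, v, a, b; split=> //; first by rewrite tE vE catA.
have hl : has_cell T (last (0, 0) t).
  by apply: (path_jdt_has_cell inv_T0 pt); exact: mem_last.
move: nt hl; rewrite vE !last_cat E last_cells_below; case: (last _ v) => i j.
by move=> /jdt_next_none; rewrite !inv_cell_T => -[n1 n2] /andP[ir jc];
  congr (_, _); lia.
Qed.

(** * Effect of one gromotion, stretch by stretch *)

Section Decomposed.

Variables (s u : seq cell) (a b : nat).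
Hypotheses (UE : jdt_path U = (0, 0) :: s) (Us : path (jdt_step U) (0, 0) s)
  (sE : last (0, 0) s = (a, b)) (b_lt : b < c) (hb : h b = a.+1)
  (hb1 : b.+1 < c -> h b.+1 <= a)
  (TE : jdt_path T = (0, 0) :: s ++ cells_below a b ++ u)
  (Ts : path (jdt_step T) (0, 0) s)
  (Tb : path (jdt_step T) (a, b) (cells_below a b))
  (Tu : path (jdt_step T) (a + r, b) u)
  (uE : last (a + r, b) u = ((r + r).-1, c.-1)).

Lemma dec_a_lt : a < r.
Proof. by rewrite -hb; exact: (inv_h inv). Qed.

Lemma dec_mem_s q : q \in (0, 0) :: s -> has_cell U q.
Proof. exact: (path_jdt_has_cell inv_U0 Us). Qed.

(** In column [b] the hole is now strictly below row [a + r]; further right the columns of [U] have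
    height at most [a]. *)
Lemma dec_mem_u i j : (i, j) \in u ->
  [/\ j < c, i < r + r, a + r <= i & h j + r <= i].
Proof.
move=> iju; have [/= ai bj ab] := path_jdt_ge Tu iju.
have : has_cell T (i, j).
  apply: (path_jdt_has_cell _ Tu); last by rewrite inE iju orbT.
  by rewrite inv_cell_T b_lt; have := dec_a_lt; lia.
rewrite inv_cell_T => /andP[ir jc].
have [E|ne] := eqVneq j b; first by rewrite E in ab *; rewrite hb; split=> //;
  lia.
have bj1 : b < j by lia.
have := hb1 (leq_ltn_trans bj1 jc); have := inv_h_mono bj1 jc.
by split=> //; lia.
Qed.

Lemma dec_path : path (jdt_step T) (0, 0) (s ++ cells_below a b ++ u).
Proof. by rewrite !cat_path Ts sE Tb last_cells_below Tu. Qed.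

Lemma dec_last : last (0, 0) (s ++ cells_below a b ++ u) = ((r + r).-1, c.-1).
Proof. by rewrite !last_cat sE last_cells_below. Qed.

(** The row [i] is crossed in exactly one stretch: the first moves an entry of [U], the second one
    of [Q], the third a new one. *)
Lemma dec_slide_into_row i : i.+1 < r + r ->
  exists2 x, slide_into_row T i = [:: x]
  & if a <= i < a + r then x = n + entry Q (i - a, b)
    else (x <= n) || (n + n < x <= n + n + m).
Proof.
move=> ir; have ar := dec_a_lt.
rewrite /slide_into_row (jdt_movesE TE) !zip_path_cat !filter_cat !map_cat.
rewrite sE last_cells_below.
have /= := slide_segment i Ts; have /= := slide_segment i Tb.
have /= := slide_segment i Tu; rewrite sE last_cells_below uE /=.
have [ia|ai] := ltnP i a.
  rewrite ifN /=; last lia; move=> -> -> [[i' j] [qs _ ->]];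
    exists (entry T (i', j)) => //.
  have := dec_mem_s (mem_behead (s := (0, 0) :: s) qs).
  by rewrite (inv_U inv) => /andP[jc ih]; have [-> ->] := inv_low inv jc ih.
have [iar|ari] := ltnP i (a + r).
  move=> /= -> [[i' j] [qt /= i'E ->]] ->.
  exists (entry T (i', j)) => //; move: qt;
    rewrite mem_cells_below => /andP[/eqP -> _].
  have -> : i' = h b + (i - a) by rewrite hb; lia.
  by rewrite (inv_mid inv) //; lia.
rewrite ifT /=; last lia; move=> [[i' j] [qu /= i'E ->]] -> ->.
exists (entry T (i', j)) => //.
have [jc ir' _ hi] := dec_mem_u qu.
by apply/orP; right; exact: (inv_high inv jc hi ir').
Qed.

Let h' j := if j == b then a else h j.

Lemma dec_entry_gromotion q : entry (gromotion T) q =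
  if q == ((r + r).-1, c.-1) then (\max_(x <- flatten T) x).+1 else
  if [|| q \in belast (0, 0) s, q \in belast (a, b) (cells_below a b)
       | q \in belast (a + r, b) u]
  then oapp (entry T) 0 (jdt_next T q) else entry T q.
Proof.
rewrite /gromotion entry_set_entry (jdt_endE TE) dec_last; case: eqP => // _.
rewrite (entry_jdt_slide TE dec_path) !belast_cat !mem_cat sE.
by rewrite last_cells_below.
Qed.

Lemma dec_has_cell i j :
  has_cell (evacuation_step U) (i, j) = (j < c) && (i < h' j).
Proof.
have eE := jdt_endE UE; rewrite sE in eE.
have /andP[_ ah] : (b < c) && (a < h b) by rewrite b_lt hb ltnSn.
rewrite /evacuation_step eE has_cell_drop_cell ?(has_cell_jdt_slide inv_U0 UE
  Us) //.
- rewrite (inv_U inv) -pair_eqE /= /h'; case: (j =P b) => [->|_]; rewrite ?hb;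
    lia.
- by rewrite (inv_U inv) b_lt.
- by rewrite (inv_U inv); lia.
Qed.

Lemma dec_entry_evac i j : j < c -> i < h' j ->
  entry (evacuation_step U) (i, j) = entry (jdt_slide U) (i, j).
Proof. by move=> jc ih; rewrite entry_drop_cell // dec_has_cell jc. Qed.

(** This puts the new entry, the maximum plus one, in the range of [inv_high] for [m + 1]. The lower
    bound comes from the entry [n] of [Q]. *)
Lemma dec_max : n + n <= \max_(x <- flatten T) x <= n + n + m.
Proof.
have n_gt0 : 0 < n <= r * c by rewrite /n leqnn andbT muln_gt0 r_gt0.
apply/andP; split.
  have [k [j [kr jc E]]] := std_surj std_Q n_gt0.
  apply: leq_bigmax_seq => //; rewrite -{2}E -(inv_mid inv) //.
  by apply/mem_flattenP; exists (h j + k, j) => //; rewrite inv_cell_T jc;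
    have := inv_h inv jc; lia.
apply/bigmax_leqP_seq => x /mem_flattenP[[i j]];
  rewrite inv_cell_T => /andP[ir jc] <- _.
have [ih|hi] := ltnP i (h j); first by have [-> ?] := inv_low inv jc ih; lia.
have [hri|] := leqP (h j + r) i; first by have := inv_high inv jc hri ir; lia.
rewrite -ltn_subLR // => kr; have := inv_mid inv jc kr; rewrite subnKC // => ->.
by have := std_bound std_Q kr jc; rewrite -/n; lia.
Qed.

Lemma dec_inv : gromotion_inv m.+1 (evacuation_step U) (gromotion T) h'.
Proof.
have ar := dec_a_lt; have h'h j : h' j <= h j by rewrite /h';
  case: eqP => // ->; lia.
have hr j (jc : j < c) := inv_h inv jc.
have sub_s q : q \in belast (0, 0) s -> has_cell U q.
  by move=> /mem_belast; exact: dec_mem_s.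
have sub_u i j : (i, j) \in belast (a + r, b) u -> a + r <= i /\ h' j + r <= i.
  move=> /mem_belast; rewrite inE => /orP[/eqP[-> ->]|/dec_mem_u[_ _ ari hri]].
    by rewrite /h' eqxx.
  by have := h'h j; lia.
split.
- exact: dec_has_cell.
- by move=> j jc; exact: leq_trans (h'h j) (hr j jc).
- have := inv_sum inv; rewrite (bigD1 (Ordinal b_lt)) //= hb.
  rewrite [in X in _ -> X](bigD1 (Ordinal b_lt)) //= {1}/h' eqxx.
  rewrite [in X in _ -> X](eq_bigr (fun j : 'I_c => h j)) => [|j jb];
    first by lia.
  by rewrite -val_eqE /= in jb; rewrite /h' (negPf jb).
- have sh := shape_jdt_slide inv_T0 TE dec_path.
  rewrite /gromotion shape_set_entry ?sh ?(inv_T inv) //.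
  rewrite (has_cell_eq_shape _ sh).
  exact: (has_cell_jdt_end inv_T0 TE dec_path).
- move=> i j jc ih'; have ih := leq_trans ih' (h'h j); have := hr j jc => hjr.
  rewrite dec_entry_evac // dec_entry_gromotion (entry_jdt_slide UE Us) ifN;
    last first.
    by rewrite -pair_eqE /=; lia.
  have -> : (i, j) \in belast (a, b) (cells_below a b) = false.
    by rewrite mem_belast_below; move: ih'; rewrite /h'; case: eqP => //=; lia.
  have -> : (i, j) \in belast (a + r, b) u = false.
    by apply/negP => /sub_u[]; lia.
  rewrite !orbF; case: ifP => [qs|_]; last exact: (inv_low inv jc ih).
  (* On the path in [U] both slides draw from the same neighbour, again a cell of [U]. *)
  have [[i' j'] q's qE] := path_jdt_next Us qs.
  rewrite qE (inv_jdt_next (sub_s _ qs) qE) /=.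
  have := dec_mem_s (mem_behead (s := (0, 0) :: s) q's).
  by rewrite (inv_U inv) => /andP[j'c ih'']; exact: (inv_low inv j'c ih'').
- move=> k j jc kr; rewrite dec_entry_gromotion.
  have := hr j jc => hjr.
  have [E|ne] := eqVneq j b.
    (* In column [b] the run raises the whole column of [Q] by one row. *)
    rewrite E /h' eqxx mem_belast_below eqxx /=.
    rewrite ifN; last by rewrite -pair_eqE /=; lia.
    rewrite ifT; last by apply/or3P; constructor 2; lia.
    rewrite (inv_next_below b_lt hb hb1 kr) /= -(inv_mid inv b_lt kr) hb.
    by congr (entry _ (_, _)); lia.
  have h'j : h' j = h j by rewrite /h' (negPf ne).
  rewrite h'j mem_belast_below (negPf ne) /=.
  have nU : ~~ has_cell U (h j + k, j) by rewrite (inv_U inv) jc; lia.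
  have -> : (h j + k, j) \in belast (0, 0) s = false.
    by apply/negP => /sub_s; exact/negP.
  have -> : (h j + k, j) \in belast (a + r, b) u = false.
    by apply/negP => /sub_u[]; rewrite h'j; lia.
  rewrite /= ifN ?(inv_mid inv) // -pair_eqE /=.
  apply/negP => /andP[/eqP hjk /eqP jE].
  (* Being the last cell of the rectangle would require [h j = r], whereas [b < j] gives
     [h j <= a < r]. *)
  have bj : b < j by lia.
  have := hb1 (leq_ltn_trans bj jc); have := inv_h_mono bj jc; lia.
- move=> i j jc hi ir; rewrite dec_entry_gromotion.
  have mx := dec_max.
  case: ifP => [_|/negbT ne]; first by lia.
  have := hr j jc => hjr.
  have -> : (i, j) \in belast (0, 0) s = false.
    by apply/negP => /sub_s; rewrite (inv_U inv); lia.
  have -> : (i, j) \in belast (a, b) (cells_below a b) = false.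
    rewrite mem_belast_below; move: hi; rewrite /h'.
    by case: (j =P b) => //= _ hi; lia.
  case: ifP => /= [qu|nu].
    have [[i' j'] q'u ->] := path_jdt_next Tu qu.
    have [j'c i'r _ hi'] := dec_mem_u q'u.
    by have /= := inv_high inv j'c hi' i'r; lia.
  suff hri : h j + r <= i by have := inv_high inv jc hri ir; lia.
  have [E|jb] := eqVneq j b; last by move: hi; rewrite /h' (negPf jb).
  (* The delicate cell is (a + r, b): if [u] is empty it is the last cell and has received the new
     entry, otherwise the first move of [u] fills it. Both cases were treated above. *)
  move: hi; rewrite E /h' eqxx leq_eqVlt => /orP[/eqP iE|]; last by rewrite hb;
    lia.
  move: ne nu; rewrite E -iE -uE; case: (u) => [|q v] /=; first by rewrite eqxx.
  by rewrite mem_head.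
Qed.

End Decomposed.

Lemma inv_step : exists a b,
  [/\ jdt_end U = (a, b),
      [/\ a < r, b < c, has_cell U (a, b), ~~ has_cell U (a, b.+1)
        & ~~ has_cell U (a.+1, b)],
      forall q, has_cell (evacuation_step U) q = has_cell U q && (q != (a, b)),
      forall i, i.+1 < r + r ->
        exists2 x, slide_into_row T i = [:: x]
        & if a <= i < a + r then x = n + entry Q (i - a, b)
          else (x <= n) || (n + n < x <= n + n + m)
    & exists h', gromotion_inv m.+1 (evacuation_step U) (gromotion T) h'].
Proof.
have [s [u [a [b [[UE Us sE] [bc hb hb1] TE [Ts Tb Tu] uE]]]]] := inv_pathP.
have step := dec_inv UE Us sE bc hb hb1 TE Ts Tb Tu uE.
exists a, b; split.
- by rewrite (jdt_endE UE).
- rewrite !(inv_U inv); split=> //; [exact: dec_a_lt hb|rewrite bc hb;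
    lia|lia|lia].
- case=> i j; rewrite (inv_U step) (inv_U inv) -pair_eqE /=.
  by case: (j =P b) => [->|_]; rewrite ?hb; lia.
- exact: (dec_slide_into_row Us sE bc hb hb1 TE Ts Tb Tu uE).
- by exists (fun j => if j == b then a else h j).
Qed.

End Step.

(** * Evacuation and promotion permutations of the stack *)

Section Stack.

Variable P : tableau.
Hypothesis std_P : standard r c P.

Let S := stack n P Q.
Let U_ m := iter m evacuation_step P.
Let T_ m := iter m gromotion S.
Let e m := jdt_end (U_ m).

Lemma stack_shape : shape S = nseq (r + r) c.
Proof.
rewrite /S /stack /shape map_cat -map_comp.
rewrite (eq_map (g := size)); last by move=> t /=; rewrite size_map.
by rewrite -/(shape P) -/(shape Q) (std_shape std_P) (std_shape std_Q) -nseqD.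
Qed.

Lemma stack_inv : gromotion_inv 0 (U_ 0) (T_ 0) (fun=> r).
Proof.
have szP := standard_size std_P; have szQ := standard_size std_Q.
split=> //.
- by move=> i j; rewrite /U_ /= (has_cell_rect _ _ (std_shape std_P)) andbC.
- by rewrite sum_nat_const card_ord subn0 /n mulnC.
- exact: stack_shape.
- move=> i j jc ir; split.
    by rewrite /T_ /U_ /= /S /stack /entry /= nth_cat szP ir.
  by have /andP[] := std_bound std_P ir jc.
- move=> k j jc kr; rewrite /T_ /= /S /stack /entry /= nth_cat szP.
  rewrite ltnNge leq_addr /= addKn (nth_map [::]) ?szQ // (nth_map 0) //.
  by have := has_cell_rect k j (std_shape std_Q);
    rewrite /has_cell /= kr jc => ->.
- by move=> i j _ rri; rewrite ltnNge rri.
Qed.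

Lemma iter_inv m : m <= n -> exists h, gromotion_inv m (U_ m) (T_ m) h.
Proof.
elim: m => [|m IH] mn; first by exists (fun=> r); exact: stack_inv.
have [h inv] := IH (ltnW mn).
by have [a [b [_ _ _ _ [h' inv']]]] := inv_step mn inv; exists h'.
Qed.

Lemma evac_cellS m q : m < n ->
  has_cell (U_ m.+1) q = has_cell (U_ m) q && (q != e m).
Proof.
move=> mn; have [h inv] := iter_inv (ltnW mn).
by have [a [b [eE _ H _ _]]] := inv_step mn inv; rewrite H /e eE.
Qed.

Lemma evac_cell_le k m q : k <= m -> m <= n -> has_cell (U_ m) q ->
  has_cell (U_ k) q.
Proof.
elim: m => [|m IH]; first by rewrite leqn0 => /eqP ->.
rewrite leq_eqVlt => /orP[/eqP -> //|km] mn;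
  rewrite evac_cellS // => /andP[+ _].
by apply: IH => //; exact: ltnW.
Qed.

Lemma evac_corner m i j : m < n -> e m = (i, j) ->
  [/\ i < r, j < c, has_cell (U_ m) (i, j), ~~ has_cell (U_ m) (i, j.+1)
    & ~~ has_cell (U_ m) (i.+1, j)].
Proof.
move=> mn; have [h inv] := iter_inv (ltnW mn).
by have [a [b [eE H _ _ _]]] := inv_step mn inv; rewrite /e eE => -[<- <-].
Qed.

(** After [n] steps the column heights sum to zero, so no cell survives. *)
Lemma evac_cell_removed i j : i < r -> j < c -> exists2 k, k < n & e k = (i, j).
Proof.
move=> ir jc; apply: contrapT => H.
have U k : k <= n -> has_cell (U_ k) (i, j).
  elim: k => [|k IH] kn;
    first by rewrite /U_ /= (has_cell_rect _ _ (std_shape std_P)) ir.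
  rewrite evac_cellS // IH 1?ltnW //; apply/eqP => E; apply: H.
  by exists k.
have [h inv] := iter_inv (leqnn n).
have := U n (leqnn n); rewrite (inv_U inv) jc /=.
have := inv_sum inv; rewrite subnn => /eqP;
  rewrite sum_nat_eq0 => /forallP/(_ (Ordinal jc)).
by move=> /eqP /= ->.
Qed.

Lemma evac_end_lt k l : k < l -> l < n -> e k <> e l.
Proof.
move=> kl ln E; case El: (e l) => [i j].
have [_ _ hU _ _] := evac_corner ln El.
have := evac_cell_le kl (ltnW ln) hU.
by rewrite evac_cellS ?(ltn_trans kl) // E El eqxx andbF.
Qed.

Lemma size_flatten_standard T : standard r c T -> size (flatten T) = n.
Proof. by move=> std; rewrite size_flatten (std_shape std) sumn_nseq mulnC. Qed.

Lemma entry_evacuation k : k < n -> entry (evacuation P) (e k) = n - k.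
Proof.
move=> kn; rewrite /evacuation (size_flatten_standard std_P).
apply: (@entry_evacuation_rec _ _ _ _ k) => // l /andP[kl ln].
exact: evac_end_lt.
Qed.

(** A cell is a corner when vacated, so its right and lower neighbours were vacated earlier and
    received larger entries. *)
Lemma evacuation_standard : standard r c (evacuation P).
Proof.
have hc i j := has_cell_rect i j (std_shape std_P).
have lt p q k l : k < n -> l < n -> e k = p -> e l = q ->
  ~~ has_cell (U_ k) q ->
    entry (evacuation P) p < entry (evacuation P) q.
  move=> kn ln <- E; rewrite -{2}E !entry_evacuation // => nq.
  suff : l < k by lia.
  rewrite ltnNge; apply: contra nq => kl; apply: (evac_cell_le kl (ltnW ln)).
  by case: q E => i j /(evac_corner ln)[].
split.
- rewrite /evacuation (size_flatten_standard std_P) shape_evacuation_rec.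
    exact: std_shape.
  by move=> k kn; case E: (jdt_end _) => [i j];
    have [ir jc _ _ _] := evac_corner kn E; rewrite hc ir.
- move=> i j ir jc; have [k kn <-] := evac_cell_removed ir jc.
  by rewrite entry_evacuation //; rewrite -/n; lia.
- move=> y /andP[y0 yn]; have kn : n - y < n by rewrite -/n in yn *; lia.
  case E: (e (n - y)) => [i j]; have [ir jc _ _ _] := evac_corner kn E.
  by exists i, j; split=> //; rewrite -E entry_evacuation //;
    rewrite -/n in yn *; lia.
- move=> i j i' j' ir jc i'r j'c.
  have [k kn E] := evac_cell_removed ir jc;
    have [k' k'n E'] := evac_cell_removed i'r j'c.
  rewrite -E -E' !entry_evacuation // => kk'.
  have kE : k = k' by lia.
  by rewrite -kE E in E'; case: E' => -> ->.
- move=> i j ir jc; have [k kn E] := evac_cell_removed ir (ltnW jc).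
  have [k' k'n E'] := evac_cell_removed ir jc.
  by apply: (lt _ _ _ _ kn k'n E E'); have [] := evac_corner kn E.
- move=> i j ir jc; have [k kn E] := evac_cell_removed (ltnW ir) jc.
  have [k' k'n E'] := evac_cell_removed ir jc.
  by apply: (lt _ _ _ _ kn k'n E E'); have [] := evac_corner kn E.
Qed.

(** The first [n] letters suffice, since the north-east block meets only the first [n] rows of the
    matrix. *)
Lemma nth_prom i m : 0 < i < r + r -> m < n ->
  exists2 x, nth 0 (prom i S) m = residue (n + n) x
  & let: (a, b) := e m in
    if a <= i.-1 < a + r then x = n + entry Q (i.-1 - a, b)
    else (x <= n) || (n + n < x <= n + n + m).
Proof.
move=> ir mn.
have H k : k < n -> exists2 x, slide_into_row (T_ k) i.-1 = [:: x]
  & let: (a, b) := e k in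
    if a <= i.-1 < a + r then x = n + entry Q (i.-1 - a, b)
    else (x <= n) || (n + n < x <= n + n + k).
  move=> kn; have [h inv] := iter_inv (ltnW kn).
  by have [a [b [eE _ _ Hs _]]] := inv_step kn inv; rewrite /e eE; apply: Hs;
    lia.
have szS : size (flatten S) = n + n.
  by rewrite size_flatten stack_shape sumn_nseq mulnC mulnDl.
have [x xE xP] := H m mn; exists x => //.
(* Each of the first [n] slides contributes exactly one letter, so letter [m] stems from slide
   [m]. *)
rewrite /prom szS iotaD map_cat flatten_cat.
have -> : flatten [seq [seq residue (n + n) x | x <- slide_into_row (iter m
  gromotion S) i.-1]
    | m <- iota 0 n] =
  [seq residue (n + n) (head 0 (slide_into_row (T_ k) i.-1)) | k <- iota 0 n].
  rewrite -[RHS]flatten_map1; congr flatten; apply/eq_in_map => k.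
  by rewrite mem_iota => kn; have [y yE _] := H k kn; rewrite -/(T_ k) yE.
by rewrite nth_cat size_map size_iota mn (nth_map 0) ?size_iota // nth_iota //
  xE.
Qed.

Lemma points_NE_prom i : 0 < i < r + r ->
  points_NE n (prom i S) =
  [set p | exists a b, [/\ a < r, b < c, a <= i.-1 < a + r
     & p = (Posz (entry Q (i.-1 - a, b)), Posz (entry (evacuation P) (a, b)))]].
Proof.
move=> ir; apply/seteqP; split=> p.
- case=> x [y [+ ->]]; rewrite !mxE /=; case: eqP => [E _|_ //].
  have [z zE] := nth_prom ir (ltn_ord x).
  case ex: (e x) => [a b]; have [ar bc _ _ _] := evac_corner (ltn_ord x) ex.
  rewrite zE /residue in E; case: ifP => [ai zQ|_ zn]; last first.
    (* Entries of the outer stretches are at most [n] or in the interval from [2n + 1] to [2n + x];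
       their residues are at most [n], outside the block. *)
    exfalso; have xn := ltn_ord x; have yn := ltn_ord y.
    have : z.-1 %% (n + n) < n; last by lia.
    have [zn'|zn'] := leqP z n; first by rewrite modn_small; lia.
    have -> : z.-1 = z.-1 - (n + n) + (n + n) by lia.
    by rewrite modnDr modn_small; lia.
  exists a, b; split=> //; rewrite -ex entry_evacuation //.
  have := @std_bound _ _ _ std_Q (i.-1 - a) b; rewrite -/n => Qb.
  rewrite zQ modn_small in E; last by lia.
  by have xn := ltn_ord x; congr (_, _); lia.
- case=> a [b [ar bc ai ->]]; have [k kn ek] := evac_cell_removed ar bc.
  have iar : i.-1 - a < r by lia.
  have := std_bound std_Q iar bc; rewrite -/n => Qb.
  have yn : (entry Q (i.-1 - a, b)).-1 < n by lia.
  exists (Ordinal kn), (Ordinal yn); split.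
    rewrite !mxE /=; have [z ->] := nth_prom ir kn; rewrite ek ai => ->.
    rewrite /residue modn_small; last by lia.
    by case: eqP => //; lia.
  by rewrite -ek entry_evacuation //=; congr (_, _); lia.
Qed.

End Stack.

End Gromotion.

(** * Promotion permutations as grids, and conclusion *)

Lemma ne_points_NE_prom r c P Q k : 0 < r -> 0 < c ->
  standard r c P -> standard r c Q -> k <= r - 1 ->
  points_NE (r * c) (prom (r + k) (stack (r * c) P Q)) =
  grid_points c (r - k) (ne_abscissa r Q)
    (fun a b => ne_ordinate (evacuation P) (k + a) b) 0.
Proof.
move=> r0 c0 stdP stdQ kr; rewrite points_NE_prom //; last by lia.
apply/seteqP; split=> p.
(* The condition on [a] reduces to [k <= a], whence the shift by [k]. *)
- case=> a [b [ar bc ai ->]]; exists (a - k), b; split=> //; first by lia.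
  by rewrite /ne_abscissa /ne_ordinate;
    congr (Posz (entry _ (_, _)), Posz (entry _ (_, _))); lia.
- case=> a [b [ar _ bc ->]]; exists (k + a), b; split=> //; [lia|lia|].
  by rewrite /ne_abscissa /ne_ordinate;
    congr (Posz (entry _ (_, _)), Posz (entry _ (_, _))); lia.
Qed.

Lemma sw_points_NE_prom r c P Q k : 0 < r -> 0 < c ->
  standard r c P -> standard r c Q -> k <= r - 1 ->
  points_NE (r * c) (prom (r - k) (stack (r * c) P Q)) =
  grid_points c (r - k) (sw_abscissa c Q)
    (fun a b => sw_ordinate r c (evacuation P) (k + a) b) 0.
Proof.
move=> r0 c0 stdP stdQ kr; rewrite points_NE_prom //; last by lia.
apply/seteqP; split=> p.
(* Here the condition is [a <= r - 1 - k], and the row index is reversed within this range. *)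
- case=> a [b [ar bc ai ->]]; exists (r.-1 - k - a), (c.-1 - b); split=> //;
    [lia|lia|].
  by rewrite /sw_abscissa /sw_ordinate;
    congr (Posz (entry _ (_, _)), Posz (entry _ (_, _))); lia.
- case=> a [b [ar _ bc ->]]; exists (r.-1 - k - a), (c.-1 - b); split=> //;
    [lia|lia|lia|].
  by rewrite /sw_abscissa /sw_ordinate;
    congr (Posz (entry _ (_, _)), Posz (entry _ (_, _))); lia.
Qed.

Theorem theorem3p1 (r c : nat) (P Q : tableau) (r_gt0 : 0 < r) (c_gt0 : 0 < c)
    (SYT_P : is_SYT r c P) (SYT_Q : is_SYT r c Q) :
  let n := r * c in
  let S := stack n P Q in
  let rho i := prom i S in
  let A := points_NE n (rho r) in
  [/\ viennot n A = (evacuation P, Q),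
      forall k, k <= r - 1 ->
        points_NE n (rho (r + k)) = iter_skeleton k ne_le A /\
        points_NE n (rho (r - k)) = iter_skeleton k sw_le A
    & forall k j, k <= r - 1 ->
        line_skeleton ne_le (shadow_line ne_le (iter_skeleton k ne_le A) j)
          = shadow_line ne_le (iter_skeleton k.+1 ne_le A) j /\
        line_skeleton sw_le (shadow_line sw_le (iter_skeleton k sw_le A) j)
          = shadow_line sw_le (iter_skeleton k.+1 sw_le A) j].
Proof.
move=> n S rho A.
have stdP := is_SYT_standard SYT_P; have stdQ := is_SYT_standard SYT_Q.
have stdE := evacuation_standard r_gt0 c_gt0 stdQ stdP.
(* The case [k = 0] presents the same set [A] as a grid for each direction. *)
have neA : A = grid_points c r (ne_abscissa r Q) (ne_ordinate (evacuation P)) 0.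
  rewrite /A /rho -[in prom r](addn0 r) ne_points_NE_prom //.
  by rewrite subn0.
have swA : A = grid_points c r (sw_abscissa c Q) (sw_ordinate r c (evacuation
  P)) 0.
  rewrite /A /rho -[in prom r](subn0 r) sw_points_NE_prom //.
  by rewrite subn0.
split.
- by rewrite neA viennot_grid.
- move=> k kr; split.
    rewrite /rho ne_points_NE_prom // neA.
    by apply/esym; apply: iter_skeleton_grid (ne_grid_mono stdQ stdE); lia.
  rewrite /rho sw_points_NE_prom // swA.
  by apply/esym; apply: iter_skeleton_grid (sw_grid_mono stdQ stdE); lia.
- move=> k j kr; split.
    by rewrite neA; apply: iter_line_skeleton_grid (ne_grid_mono stdQ stdE);
      lia.
  by rewrite swA; apply: iter_line_skeleton_grid (sw_grid_mono stdQ stdE); lia.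
Qed.
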